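(* An infinite set $A\subseteq\omega$ is majorreducible if and only if it is both majorenumerable and introreducible.
   Context: $p_A$ is the principal function of $A$ ($p_A(n)$ is the $n$-th element of $A$ in increasing order). An enumeration operator $\Theta$ is a c.e. set of pairs $\langle u,n\rangle$, with $\Theta(X)=\{n:\exists u\,(D_u\subseteq X\wedge\langle u,n\rangle\in\Theta)\}$; $A\le_e X$ if $A=\Theta(X)$ for some enumeration operator. $A$ is majorreducible if every function $f$ with $f(n)\ge p_A(n)$ for all $n$ computes $A$ (oracle the graph of $f$); majorenumerable if $A\le_e\mathrm{graph}(f)$ for every such $f$; introreducible if $A\le_T C$ for every infinite $C\subseteq A$. *)

(* Defs.v *)
From Stdlib Require Cantor.
From mathcomp Require Import all_boot.
From mathcomp Require Import boolp classical_sets functions cardinality.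

Set Implicit Arguments.
Unset Strict Implicit.
Unset Printing Implicit Defensive.

Local Open Scope classical_set_scope.

Definition cpair (x y : nat) : nat := Cantor.to_nat (x, y).
Definition cfst (z : nat) : nat := (Cantor.of_nat z).1.
Definition csnd (z : nat) : nat := (Cantor.of_nat z).2.

(* A partial function from nat to nat is represented by its graph relation. *)
Definition pfun_nat := nat -> nat -> Prop.

Definition pf_total (g : nat -> nat) : pfun_nat := fun x y => y = g x.

Definition pf_pair (f g : pfun_nat) : pfun_nat := fun x z =>
  exists a b, [/\ f x a, g x b & z = cpair a b].

Definition pf_comp (f g : pfun_nat) : pfun_nat := fun x z =>
  exists2 y, g x y & f y z.

(* h(a, 0) = f(a) and h(a, n + 1) = g(a, (n, h(a, n))). *)
Fixpoint prim_rec (f g : pfun_nat) (a n : nat) : nat -> Prop :=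
  if n is m.+1
  then fun y => exists2 r, prim_rec f g a m r & g (cpair a (cpair m r)) y
  else f a.

Definition pf_prec (f g : pfun_nat) : pfun_nat := fun x =>
  prim_rec f g (cfst x) (csnd x).

(* Unbounded minimization: f(a, m) must converge for every m below the least
   zero. *)
Definition pf_mu (f : pfun_nat) : pfun_nat := fun a n =>
  f (cpair a n) 0 /\
  forall m, m < n -> exists2 y, f (cpair a m) y & y != 0.

(* The partial functions that are recursive in a set O of total functions.
   All functions are unary, several arguments being coded by cpair; the
   identity is the pairing of cfst and csnd. *)
Inductive partrec_in (O : set (nat -> nat)) : pfun_nat -> Prop :=
| partrec_oracle g : O g -> partrec_in O (pf_total g)
| partrec_zero : partrec_in O (pf_total (fun=> 0))
| partrec_succ : partrec_in O (pf_total succn)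
| partrec_fst : partrec_in O (pf_total cfst)
| partrec_snd : partrec_in O (pf_total csnd)
| partrec_pair f g : partrec_in O f -> partrec_in O g ->
    partrec_in O (pf_pair f g)
| partrec_comp f g : partrec_in O f -> partrec_in O g ->
    partrec_in O (pf_comp f g)
| partrec_prec f g : partrec_in O f -> partrec_in O g ->
    partrec_in O (pf_prec f g)
| partrec_mu f : partrec_in O f -> partrec_in O (pf_mu f).

Definition ce (W : set nat) : Prop :=
  exists2 f, partrec_in set0 f & W = [set x | exists y, f x y].

Definition charfun (A : set nat) : nat -> nat := fun x => x \in A.

Definition turing_le (A B : set nat) : Prop :=
  partrec_in [set charfun B] (pf_total (charfun A)).

(* The finite set D_u with canonical index u, the sum of the 2 ^ x, x in D_u. *)
Definition finset_code (u : nat) : set nat := [set x | odd (u %/ 2 ^ x)].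

Definition enum_apply (Theta X : set nat) : set nat :=
  [set n | exists u, finset_code u `<=` X /\ Theta (cpair u n)].

Definition enum_le (A X : set nat) : Prop :=
  exists2 Theta, ce Theta & A = enum_apply Theta X.

Definition graph (f : nat -> nat) : set nat :=
  [set z | exists n, z = cpair n (f n)].

Definition count_below (A : set nat) (x : nat) : nat :=
  count (fun y => y \in A) (iota 0 x).

(* Indexing starts at 0: principal A 0 is the least element of A.  The default
   value 0 of xget is irrelevant when A is infinite. *)
Definition principal (A : set nat) (n : nat) : nat :=
  xget 0 [set x | A x /\ count_below A x = n].

Definition majorizes (f g : nat -> nat) : Prop := forall n, g n <= f n.

Definition majorreducible (A : set nat) : Prop :=
  forall f, majorizes f (principal A) -> turing_le A (graph f).

Definition majorenumerable (A : set nat) : Prop :=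
  forall f, majorizes f (principal A) -> enum_le A (graph f).

Definition introreducible (A : set nat) : Prop :=
  forall C, infinite_set C -> C `<=` A -> turing_le A C.

Lemma count_belowS (A : set nat) x : count_below A x.+1 = count_below A x + (x \in A).
Proof. by rewrite /count_below -addn1 iotaD count_cat /= addn0. Qed.

Lemma leq_count_below (A : set nat) : {homo count_below A : x y / x <= y}.
Proof.
move=> x y /subnK <-; elim: (y - x) => // n IHn.
by rewrite addSn count_belowS (leq_trans IHn) ?leq_addr.
Qed.

Lemma ltn_count_below (A : set nat) x y : A x -> x < y -> count_below A x < count_below A y.
Proof.
move=> Ax /(@leq_count_below A); apply: leq_trans.
by rewrite count_belowS mem_set // addn1.
Qed.

Lemma count_below_inj (A : set nat) x y : A x -> A y ->
  count_below A x = count_below A y -> x = y.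
Proof.
move=> Ax Ay e; case: (ltngtP x y) => //.
  by move=> /(ltn_count_below Ax); rewrite e ltnn.
by move=> /(ltn_count_below Ay); rewrite e ltnn.
Qed.

Lemma principalP (A : set nat) n : infinite_set A ->
  A (principal A n) /\ count_below A (principal A n) = n.
Proof.
move=> Ainf; suff : exists x, A x /\ count_below A x = n by move/(xgetPex 0).
have unb m : exists x, m <= count_below A x.
  elim: m => [|m [x mx]]; first by exists 0.
  have [y [Ay xy]] : exists y, A y /\ x <= y.
    apply: contrapT => /forallNP h; apply: Ainf.
    apply: (@sub_finite_set _ _ `I_x); last exact: finite_II.
    move=> y Ay /=; rewrite ltnNge; apply/negP => xy.
    exact: (h y).
  exists y.+1; apply: leq_ltn_trans (ltn_count_below Ay (ltnSn y)).
  exact: leq_trans mx (@leq_count_below A _ _ xy).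
have [[|x] nx xmin] := ex_minnP (unb n.+1); first by [].
have xn : count_below A x <= n.
  by rewrite leqNgt; apply/negP => /xmin; rewrite ltnn.
exists x; move: nx; rewrite count_belowS.
have [/set_mem Ax|_] := boolP (x \in A); last by rewrite addn0 ltnNge xn.
by rewrite addn1 ltnS => nx; split => //; apply/eqP; rewrite eqn_leq xn.
Qed.

Lemma ltn_principal (A : set nat) : infinite_set A -> {homo principal A : m n / m < n}.
Proof.
move=> Ainf m n; apply: contraTT; rewrite -!leqNgt => /(@leq_count_below A).
by rewrite !(principalP _ Ainf).2.
Qed.

Lemma range_principal (A : set nat) : infinite_set A -> range (principal A) = A.
Proof.
move=> Ainf; apply/seteqP; split=> [_ [n _ <-]|x Ax].
  by case: (principalP n Ainf).
have [Ap e] := principalP (count_below A x) Ainf.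
by exists (count_below A x) => //; exact: count_below_inj e.
Qed.

(* Main.v *)
Require Import Defs.
From mathcomp Require Import all_boot.
From mathcomp Require Import boolp classical_sets functions cardinality.

(* Let A be infinite.  If C is an infinite subset of A, then p_C majorizes p_A
   and the graph of p_C is computable from C, so majorreducibility implies
   introreducibility.  It implies majorenumerability because A <=_T graph f
   yields A <=_e graph f: a finite part of the graph of f answers positively the
   queries it contains and negatively those it conflicts with.  Conversely, if f
   majorizes p_A and A <=_e graph f, then A is c.e. in graph f, hence has an
   infinite subset C computable from graph f; introreducibility gives
   A <=_T C <=_T graph f. *)

Set Implicit Arguments.
Unset Strict Implicit.
Unset Printing Implicit Defensive.

Local Open Scope classical_set_scope.

(** * Pair coding and relative computability of total functions *)

Lemma cfst_cpair x y : cfst (cpair x y) = x.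
Proof. by rewrite /cfst /cpair Cantor.cancel_of_to. Qed.

Lemma csnd_cpair x y : csnd (cpair x y) = y.
Proof. by rewrite /csnd /cpair Cantor.cancel_of_to. Qed.

Lemma cpair_eta z : cpair (cfst z) (csnd z) = z.
Proof.
by rewrite /cpair /cfst /csnd -surjective_pairing Cantor.cancel_to_of.
Qed.

Definition cpairE := (cfst_cpair, csnd_cpair).

Definition rec_in (O : set (nat -> nat)) (f : nat -> nat) : Prop :=
  partrec_in O (pf_total f).

Definition rec2_in (O : set (nat -> nat)) (f : nat -> nat -> nat) : Prop :=
  rec_in O (fun z => f (cfst z) (csnd z)).

Lemma pfun_eqP (f g : pfun_nat) : (forall x y, f x y <-> g x y) -> f = g.
Proof. by move=> fg; apply/funext => x; apply/funext => y; apply/propext. Qed.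

(** Each oracle call in a derivation over [O] is replaced by a computation over [O']; transitivity
    of [turing_le] and the absence of oracle calls over [set0] are special cases. *)
Lemma partrec_in_trans (O O' : set (nat -> nat)) (f : pfun_nat) :
  (forall g, O g -> rec_in O' g) -> partrec_in O f -> partrec_in O' f.
Proof.
move=> OO'; elim=> [g /OO'//|||||f1 g1 _ ? _ ?|f1 g1 _ ? _ ?|f1 g1 _ ? _ ?|f1 _ ?].
- exact: partrec_zero.
- exact: partrec_succ.
- exact: partrec_fst.
- exact: partrec_snd.
- exact: partrec_pair.
- exact: partrec_comp.
- exact: partrec_prec.
- exact: partrec_mu.
Qed.

Lemma turing_le_trans (A B C : set nat) :
  turing_le A B -> turing_le B C -> turing_le A C.
Proof. by move=> AB BC; apply: partrec_in_trans AB => g ->. Qed.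

Lemma rec_in_set0 (O : set (nat -> nat)) f : rec_in set0 f -> rec_in O f.
Proof. exact: partrec_in_trans. Qed.

(** * Closure of the total recursive functions under arithmetic and bounded search *)

Section ClosureProperties.
Variable O : set (nat -> nat).
Implicit Types (f g h : nat -> nat) (b c : nat -> bool).

Lemma rec_comp f g : rec_in O f -> rec_in O g -> rec_in O (fun x => f (g x)).
Proof.
move=> rf rg; suff -> : rec_in O (fun x => f (g x)) =
  partrec_in O (pf_comp (pf_total f) (pf_total g)) by exact: partrec_comp.
congr (partrec_in O _); apply: pfun_eqP => x y; split=> [->|[_ -> ->]//].
by exists (g x).
Qed.

Lemma rec_cpair f g :
  rec_in O f -> rec_in O g -> rec_in O (fun x => cpair (f x) (g x)).
Proof.
move=> rf rg; suff -> : rec_in O (fun x => cpair (f x) (g x)) =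
  partrec_in O (pf_pair (pf_total f) (pf_total g)) by exact: partrec_pair.
congr (partrec_in O _); apply: pfun_eqP => x y; split=> [->|[_ [_ [-> -> ->]]]//].
by exists (f x), (g x).
Qed.

Lemma rec_cfst f : rec_in O f -> rec_in O (fun x => cfst (f x)).
Proof. exact/rec_comp/partrec_fst. Qed.

Lemma rec_csnd f : rec_in O f -> rec_in O (fun x => csnd (f x)).
Proof. exact/rec_comp/partrec_snd. Qed.

Lemma rec_succ f : rec_in O f -> rec_in O (fun x => (f x).+1).
Proof. exact/rec_comp/partrec_succ. Qed.

Lemma rec_id : rec_in O (fun x => x).
Proof.
have -> : (fun x => x) = (fun x => cpair (cfst x) (csnd x)).
  by apply/funext => x; rewrite cpair_eta.
by apply: rec_cpair; [exact: partrec_fst|exact: partrec_snd].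
Qed.

Lemma rec_const n : rec_in O (fun=> n).
Proof. by elim: n => [|n IHn]; [exact: partrec_zero|exact: rec_succ]. Qed.

Lemma rec2_comp (F : nat -> nat -> nat) f g :
  rec2_in O F -> rec_in O f -> rec_in O g -> rec_in O (fun x => F (f x) (g x)).
Proof.
move=> rF rf rg; have -> : (fun x => F (f x) (g x)) =
    (fun x => (fun z => F (cfst z) (csnd z)) (cpair (f x) (g x))).
  by apply/funext => x /=; rewrite !cpairE.
exact: rec_comp rF (rec_cpair rf rg).
Qed.

(** Primitive recursion with a parameter [x], a counter and the previous value, packed as
    [cpair x (cpair m r)]. The bounded loops below are all instances of it. *)
Lemma rec_iteri (s : nat -> nat -> nat -> nat) f g :
  rec_in O (fun z => s (cfst z) (cfst (csnd z)) (csnd (csnd z))) ->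
  rec_in O f -> rec_in O g ->
  rec_in O (fun x => iteri (f x) (s x) (g x)).
Proof.
move=> rs rf rg.
apply: (@rec2_comp (fun x n => iteri n (s x) (g x)) (fun x => x) f) rec_id rf.
rewrite /rec2_in /rec_in.
have -> : pf_total (fun z => iteri (csnd z) (s (cfst z)) (g (cfst z))) =
  pf_prec (pf_total g) (pf_total (fun z =>
    s (cfst z) (cfst (csnd z)) (csnd (csnd z)))); last exact: partrec_prec.
apply: pfun_eqP => z y; rewrite /pf_total /pf_prec.
elim: (csnd z) y => //= n IHn y; split=> [->|[r]].
  by exists (iteri n (s (cfst z)) (g (cfst z))); [exact/IHn|rewrite !cpairE].
by move=> /IHn ->; rewrite !cpairE.
Qed.

(** A case distinction is a loop that runs zero or one time, starting from [g x] and overwriting it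
    with [f x]. *)
Lemma rec_ifte b f g :
  rec_in O (fun x => b x) -> rec_in O f -> rec_in O g ->
  rec_in O (fun x => if b x then f x else g x).
Proof.
move=> rb rf rg.
have -> : (fun x => if b x then f x else g x) =
    (fun x => iteri (b x) ((fun x _ _ => f x) x) (g x)).
  by apply/funext => x; case: (b x).
by apply: rec_iteri => //; apply: rec_comp => //; exact: partrec_fst.
Qed.

Lemma rec_negb b : rec_in O (fun x => b x) -> rec_in O (fun x => ~~ b x).
Proof.
move=> rb; have -> : (fun x => nat_of_bool (~~ b x)) = (fun x => if b x then 0 else 1).
  by apply/funext => x; case: (b x).
by apply: rec_ifte => //; exact: rec_const.
Qed.

Lemma rec_andb b c : rec_in O (fun x => b x) -> rec_in O (fun x => c x) ->
  rec_in O (fun x => b x && c x).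
Proof.
move=> rb rc; have -> : (fun x => nat_of_bool (b x && c x)) =
    (fun x => if b x then nat_of_bool (c x) else 0).
  by apply/funext => x; case: (b x).
by apply: rec_ifte => //; exact: rec_const.
Qed.

Lemma rec_pred f : rec_in O f -> rec_in O (fun x => (f x).-1).
Proof.
move=> rf; have -> : (fun x => (f x).-1) =
    (fun x => iteri (f x) ((fun _ m _ => m) x) 0).
  by apply/funext => x; case: (f x).
apply: rec_iteri => //; last exact: rec_const.
exact/rec_cfst/rec_csnd/rec_id.
Qed.

Lemma rec_sub f g : rec_in O f -> rec_in O g -> rec_in O (fun x => f x - g x).
Proof.
move=> rf rg; have -> : (fun x => f x - g x) =
    (fun x => iteri (g x) ((fun _ _ r => r.-1) x) (f x)).
  apply/funext => x; elim: (g x) => [|n IHn] /=; first by rewrite subn0.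
  by rewrite subnS IHn.
apply: rec_iteri => //; exact/rec_pred/rec_csnd/rec_csnd/rec_id.
Qed.

Lemma rec_leq f g : rec_in O f -> rec_in O g -> rec_in O (fun x => f x <= g x).
Proof.
move=> rf rg; have -> : (fun x => nat_of_bool (f x <= g x)) = (fun x => 1 - (f x - g x)).
  by apply/funext => x; rewrite /leq; case: (f x - g x).
by apply: rec_sub; [exact: rec_const|exact: rec_sub].
Qed.

Lemma rec_eqn f g : rec_in O f -> rec_in O g -> rec_in O (fun x => f x == g x).
Proof.
by move=> rf rg; under eq_fun do rewrite eqn_leq; apply: rec_andb; exact: rec_leq.
Qed.

Lemma rec_count (p : nat -> nat -> bool) f :
  rec_in O (fun z => p (cfst z) (csnd z)) -> rec_in O f ->
  rec_in O (fun x => count (p x) (iota 0 (f x))).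
Proof.
move=> rp rf; have -> : (fun x => count (p x) (iota 0 (f x))) =
    (fun x => iteri (f x) ((fun x m r => if p x m then r.+1 else r) x) 0).
  apply/funext => x; elim: (f x) => // n IHn; rewrite iteriS -IHn.
  by rewrite -addn1 iotaD count_cat /= addn0; case: (p x n); rewrite ?addn1 ?addn0.
have rr : rec_in O (fun z => csnd (csnd z)) by exact/rec_csnd/rec_csnd/rec_id.
apply: rec_iteri => //; last exact: rec_const.
apply: rec_ifte => //; last exact: rec_succ.
apply: (rec2_comp (F := fun x m => p x m) rp); first exact/rec_cfst/rec_id.
exact/rec_cfst/rec_csnd/rec_id.
Qed.

Lemma rec_all (p : nat -> nat -> bool) f :
  rec_in O (fun z => p (cfst z) (csnd z)) -> rec_in O f ->
  rec_in O (fun x => all (p x) (iota 0 (f x))).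
Proof.
move=> rp rf; under eq_fun do rewrite all_count size_iota.
by apply: rec_eqn => //; exact: rec_count.
Qed.

Lemma rec_find (p : nat -> nat -> bool) f :
  rec_in O (fun z => p (cfst z) (csnd z)) -> rec_in O f ->
  rec_in O (fun x => find (p x) (iota 0 (f x))).
Proof.
(* The value [r] equals the counter [m] exactly as long as the search has failed on every index
   below [m]; afterwards it stays frozen at the index found. *)
move=> rp rf; have -> : (fun x => find (p x) (iota 0 (f x))) =
    (fun x => iteri (f x)
      ((fun x m r => if (r == m) && ~~ p x m then m.+1 else r) x) 0).
  apply/funext => x; elim: (f x) => // n IHn; rewrite iteriS -IHn.
  rewrite -addn1 iotaD find_cat has_find size_iota /=.
  case: ltngtP (find_size (p x) (iota 0 n)) => //=; first by rewrite size_iota ltnNge => /negbTE ->.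
  by move=> -> _; case: (p x n); rewrite ?addn0 ?addn1.
have rr : rec_in O (fun z => csnd (csnd z)) by exact/rec_csnd/rec_csnd/rec_id.
have rm : rec_in O (fun z => cfst (csnd z)) by exact/rec_cfst/rec_csnd/rec_id.
apply: rec_iteri => //; last exact: rec_const.
apply: rec_ifte => //; last exact: rec_succ.
apply: rec_andb; first exact: rec_eqn.
by apply/rec_negb/(rec2_comp (F := fun x m => p x m) rp) => //; exact/rec_cfst/rec_id.
Qed.

Lemma rec_odd f : rec_in O f -> rec_in O (fun x => odd (f x)).
Proof.
move=> rf; have -> : (fun x => nat_of_bool (odd (f x))) =
    (fun x => iteri (f x) ((fun _ _ r => 1 - r) x) 0).
  by apply/funext => x; elim: (f x) => //= n <-; case: (odd n).
apply: rec_iteri => //; last exact: rec_const.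
by apply: rec_sub; [exact: rec_const|exact/rec_csnd/rec_csnd/rec_id].
Qed.

Lemma rec_half f : rec_in O f -> rec_in O (fun x => (f x)./2).
Proof.
(* The recursion rests on the identity [n.+1./2 = n - n./2]. *)
move=> rf; have -> : (fun x => (f x)./2) =
    (fun x => iteri (f x) ((fun _ m r => m - r) x) 0).
  apply/funext => x; elim: (f x) => // n IHn; rewrite iteriS -IHn /=.
  by rewrite -{2}[n]odd_double_half -addnn addnA addnK uphalf_half.
apply: rec_iteri => //; last exact: rec_const.
by apply: rec_sub; [exact/rec_cfst/rec_csnd/rec_id|exact/rec_csnd/rec_csnd/rec_id].
Qed.

Lemma rec_mem_finset_code f g : rec_in O f -> rec_in O g ->
  rec_in O (fun x => odd (f x %/ 2 ^ g x)).
Proof.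
move=> rf rg; apply: rec_odd; have -> : (fun x => f x %/ 2 ^ g x) =
    (fun x => iteri (g x) ((fun _ _ r => r./2) x) (f x)).
  apply/funext => x; elim: (g x) => [|n IHn]; first by rewrite divn1.
  by rewrite expnS mulnC divnMA divn2 IHn.
by apply: rec_iteri => //; exact/rec_half/rec_csnd/rec_csnd/rec_id.
Qed.

(** [pf_mu] looks for the least zero, so it is applied to the negation of [p]; [pP] makes the search
    total. *)
Lemma rec_ex_minn (p : nat -> nat -> bool) (pP : forall x, exists n, p x n) :
  rec_in O (fun z => p (cfst z) (csnd z)) -> rec_in O (fun x => ex_minn (pP x)).
Proof.
move=> /rec_negb /partrec_mu; congr (partrec_in O _).
apply: pfun_eqP => x n; rewrite /pf_mu /pf_total !cpairE.
case: ex_minnP => m pm mmin; split=> [[]|->].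
  case pn: (p x n) => // _ nmin; apply/eqP; rewrite eqn_leq mmin // andbT leqNgt.
  by apply/negP => /nmin [_ ->]; rewrite !cpairE pm.
rewrite pm; split=> // k km; exists (nat_of_bool (~~ p x k)); rewrite ?cpairE //.
by case pk: (p x k) => //; move: (mmin _ pk); rewrite leqNgt km.
Qed.

End ClosureProperties.

(** * C.e. sets as projections, and canonical indices of finite sets *)

(** The set is the domain of the partial function searching for the least [n] with [p x n]. *)
Lemma ce_exists (p : nat -> nat -> bool) :
  rec_in set0 (fun z => p (cfst z) (csnd z)) -> ce [set x | exists n, p x n].
Proof.
move=> /rec_negb /partrec_mu rp; exists (pf_mu (pf_total (fun z => ~~ p (cfst z) (csnd z)))) => //.
apply/seteqP; split=> x /= [n].
  move=> pn; have [m pm mmin] := ex_minnP (ex_intro (fun n => p x n) n pn).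
  exists m; rewrite /pf_mu /pf_total !cpairE pm; split=> // k km.
  exists (nat_of_bool (~~ p x k)); rewrite ?cpairE //.
  by case pk: (p x k) => //; move: (mmin _ pk); rewrite leqNgt km.
by rewrite /pf_mu /pf_total !cpairE => -[pn _]; exists n; case: (p x n) pn.
Qed.

Lemma finset_code_ltn u x : finset_code u x -> x < u.
Proof.
rewrite /finset_code /= => ux; have u2 : 2 ^ x <= u.
  by rewrite leqNgt; apply/negP => /divn_small e; rewrite e in ux.
exact: leq_trans (ltn_expl x (ltnSn 1)) u2.
Qed.

Lemma finset_code_exp2 z : finset_code (2 ^ z) = [set z].
Proof.
apply/seteqP; split=> x /=; last by move=> ->; rewrite /finset_code /= divnn expn_gt0.
rewrite /finset_code /=; case: (ltngtP x z) => // [xz|zx].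
  by rewrite -expnB ?(ltnW xz) // oddX subn_eq0 leqNgt xz.
by rewrite divn_small // ltn_exp2l.
Qed.

(** Binary digits are produced from the lowest one: the induction hypothesis for the shifted
    predicate gives the upper digits, which are doubled before [p 0] is added. *)
Lemma finset_code_bounded (p : pred nat) n :
  exists u, finset_code u = [set x | (x < n) && p x].
Proof.
elim: n p => [|n IHn] p.
  by exists 0; apply/seteqP; split=> x //=; rewrite /finset_code /= div0n.
have [u uE] := IHn (p \o succn); exists (p 0 + u.*2).
apply/seteqP; split=> -[|x]; rewrite /finset_code /=.
- by rewrite divn1 oddD odd_double addbF oddb.
- rewrite expnS divnMA divn2 half_bit_double => ux.
  by have : finset_code u x by []; rewrite uE.
- by rewrite divn1 oddD odd_double addbF oddb.
- move=> xp; have : finset_code u x by rewrite uE.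
  by rewrite expnS divnMA divn2 half_bit_double.
Qed.

Lemma finset_codeU u v : exists w, finset_code w = finset_code u `|` finset_code v.
Proof.
have [w wE] := finset_code_bounded
  (fun x => odd (u %/ 2 ^ x) || odd (v %/ 2 ^ x)) (maxn u v).
exists w; rewrite wE; apply/seteqP; split=> x /=.
  by move=> /andP[_ /orP[]]; [left|right].
rewrite leq_max => -[] xu; rewrite (finset_code_ltn xu) ?orbT /=.
  by apply/orP; left.
by apply/orP; right.
Qed.

(** * Use principle: approximating oracle computations by finite positive information *)

Section FuelEvaluators.
Variable X : set nat.

(* A fuel [cpair u s] consists of finite oracle information [finset_code u] and
   a bound [s] on the length of unbounded searches. *)
Definition sound_fuel (w : nat) : Prop := finset_code (cfst w) `<=` X.

Definition fuel_le (w w' : nat) : Prop :=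
  finset_code (cfst w) `<=` finset_code (cfst w') /\ csnd w <= csnd w'.

(* The value [0] means that the fuel is insufficient, and [y.+1] that the
   computation halts with value [y]. *)
Record evaluator (h : pfun_nat) (F : nat -> nat -> nat) : Prop := Evaluator {
  evaluator_rec : rec2_in set0 F;
  evaluator_mono : forall w w' x y, sound_fuel w' -> fuel_le w w' ->
    F w x = y.+1 -> F w' x = y.+1;
  evaluatorP : forall x y,
    h x y <-> exists2 w, sound_fuel w & F w x = y.+1 }.

Lemma sound_fuel0 n : sound_fuel (cpair 0 n).
Proof. by move=> x; rewrite cpairE /finset_code /= div0n. Qed.

(** Combined with monotonicity, this lets several convergent subcomputations share one fuel. *)
Lemma fuel_directed w w' : sound_fuel w -> sound_fuel w' ->
  exists w'', [/\ sound_fuel w'', fuel_le w w'' & fuel_le w' w''].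
Proof.
move=> sw sw'; have [u uE] := finset_codeU (cfst w) (cfst w').
exists (cpair u (maxn (csnd w) (csnd w'))).
rewrite /sound_fuel /fuel_le !cpairE uE leq_maxl leq_maxr; split.
- by move=> x [/sw|/sw'].
- by split=> // x; left.
- by split=> // x; right.
Qed.

Lemma evaluator_total g : rec_in set0 g -> evaluator (pf_total g) (fun _ x => (g x).+1).
Proof.
move=> rg; split=> [|//|x y].
  exact/rec_succ/(rec_comp rg)/rec_csnd/rec_id.
split=> [->|[_ _ [<-]]//]; exists (cpair 0 0) => //; exact: sound_fuel0.
Qed.

Definition eval_pair (F G : nat -> nat -> nat) w x :=
  if (0 < F w x) && (0 < G w x) then (cpair (F w x).-1 (G w x).-1).+1 else 0.

Lemma evaluator_pair f g F G :
  evaluator f F -> evaluator g G -> evaluator (pf_pair f g) (eval_pair F G).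
Proof.
move=> [rF mF FP] [rG mG GP].
have eval_pairE w x y : eval_pair F G w x = y.+1 <->
    exists a b, [/\ F w x = a.+1, G w x = b.+1 & y = cpair a b].
  rewrite /eval_pair; split=> [|[a [b [-> -> ->]]]//].
  case: (F w x) (G w x) => [|a] [|b] //= [<-]; by exists a, b.
split=> [|w w' x y sw' ww'|x y].
- by apply: rec_ifte; [apply: rec_andb; apply: rec_leq => //|
    apply/rec_succ/rec_cpair; exact: rec_pred|]; exact: rec_const.
- move=> /eval_pairE [a [b [Fa Gb ->]]]; apply/eval_pairE; exists a, b.
  by split; [exact: mF Fa|exact: mG Gb|].
split=> [[a [b [/FP [w sw Fa] /GP [w' sw' Gb] ->]]]|].
  have [w'' [sw'' ww'' ww''']] := fuel_directed sw sw'.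
  exists w'' => //; apply/eval_pairE; exists a, b.
  by split; [exact: mF Fa|exact: mG Gb|].
move=> [w sw /eval_pairE [a [b [Fa Gb ->]]]]; exists a, b.
by split; [apply/FP; exists w|apply/GP; exists w|].
Qed.

Definition eval_comp (F G : nat -> nat -> nat) w x :=
  if 0 < G w x then F w (G w x).-1 else 0.

Lemma evaluator_comp f g F G :
  evaluator f F -> evaluator g G -> evaluator (pf_comp f g) (eval_comp F G).
Proof.
move=> [rF mF FP] [rG mG GP].
have eval_compE w x z : eval_comp F G w x = z.+1 <->
    exists2 y, G w x = y.+1 & F w y = z.+1.
  rewrite /eval_comp; split=> [|[y -> ->]//].
  by case: (G w x) => // y; exists y.
split=> [|w w' x z sw' ww'|x z].
- apply: rec_ifte; last exact: rec_const.
    by apply: rec_leq => //; exact: rec_const.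
  apply: (rec2_comp rF); first exact/rec_cfst/rec_id.
  exact: rec_pred.
- move=> /eval_compE [y Gy Fz]; apply/eval_compE; exists y.
    exact: mG Gy.
  exact: mF Fz.
split=> [[y /GP [w sw Gy] /FP [w' sw' Fz]]|].
  have [w'' [sw'' ww'' ww''']] := fuel_directed sw sw'.
  exists w'' => //; apply/eval_compE; exists y; first exact: mG Gy.
  exact: mF Fz.
move=> [w sw /eval_compE [y Gy Fz]]; exists y; first by apply/GP; exists w.
by apply/FP; exists w.
Qed.

Definition eval_prec (F G : nat -> nat -> nat) w x :=
  iteri (csnd x)
    (fun m r => if 0 < r then G w (cpair (cfst x) (cpair m r.-1)) else 0)
    (F w (cfst x)).

Lemma rec_eval_prec F G :
  rec2_in set0 F -> rec2_in set0 G -> rec2_in set0 (eval_prec F G).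
Proof.
move=> rF rG.
apply: (@rec_iteri _ (fun z m r => if 0 < r then
    G (cfst z) (cpair (cfst (csnd z)) (cpair m r.-1)) else 0)).
- have rr : rec_in set0 (fun z => csnd (csnd z)) by exact/rec_csnd/rec_csnd/rec_id.
  apply: rec_ifte; last exact: rec_const.
    by apply: rec_leq => //; exact: rec_const.
  apply: (rec2_comp rG); first exact/rec_cfst/rec_cfst/rec_id.
  apply: rec_cpair; first exact/rec_cfst/rec_csnd/rec_cfst/rec_id.
  by apply: rec_cpair; [exact/rec_cfst/rec_csnd/rec_id|exact: rec_pred].
- exact/rec_csnd/rec_csnd/rec_id.
by apply: (rec2_comp rF); [exact/rec_cfst/rec_id|exact/rec_cfst/rec_csnd/rec_id].
Qed.

Lemma evaluator_prec f g F G :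
  evaluator f F -> evaluator g G -> evaluator (pf_prec f g) (eval_prec F G).
Proof.
move=> [rF mF FP] [rG mG GP].
have stepE w a n y :
    eval_prec F G w (cpair a n.+1) = y.+1 <->
    exists2 r, eval_prec F G w (cpair a n) = r.+1 & G w (cpair a (cpair n r)) = y.+1.
  rewrite /eval_prec !cpairE /=; split=> [|[r -> ->]//].
  by case: (iteri n _ _) => // r; exists r.
have baseE w a : eval_prec F G w (cpair a 0) = F w a.
  by rewrite /eval_prec !cpairE.
have mR w w' a n y : sound_fuel w' -> fuel_le w w' ->
    eval_prec F G w (cpair a n) = y.+1 -> eval_prec F G w' (cpair a n) = y.+1.
  move=> sw' ww'; elim: n y => [|n IHn] y; first by rewrite !baseE; exact: mF.
  move=> /stepE [r /IHn Rr Gy]; apply/stepE; exists r => //; exact: mG Gy.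
split=> [|w w' x y sw' ww'|x y].
- exact: rec_eval_prec.
- by rewrite -(cpair_eta x); exact: mR.
rewrite /pf_prec -{3}(cpair_eta x).
elim: (csnd x) y => [|n IHn] y /=.
  by rewrite FP; split=> -[w sw e]; exists w; rewrite ?baseE // -e baseE.
split=> [[r /IHn [w sw Rr] /GP [w' sw' Gy]]|].
  have [w'' [sw'' ww'' ww''']] := fuel_directed sw sw'.
  exists w'' => //; apply/stepE; exists r; first exact: mR Rr.
  exact: mG Gy.
move=> [w sw /stepE [r Rr Gy]]; exists r; first by apply/IHn; exists w.
by apply/GP; exists w.
Qed.

(** The search stops at the first value [0] or [1]. The value [1] codes a genuine zero of the
    function; the value [0] signals missing fuel, and the search must not pass it, since a smaller
    zero could still appear there. *)
Definition eval_mu (F : nat -> nat -> nat) w x :=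
  let n := find (fun m => F w (cpair x m) <= 1) (iota 0 (csnd w)) in
  if (n < csnd w) && (F w (cpair x n) == 1) then n.+1 else 0.

Lemma eval_muP F w x n : eval_mu F w x = n.+1 <->
  [/\ n < csnd w, F w (cpair x n) = 1 &
      forall m, m < n -> 1 < F w (cpair x m)].
Proof.
rewrite /eval_mu; set p := fun m => _; set k := find _ _; split.
  case: ifP => // /andP[ks /eqP Fk] [<-]; split=> // m mk.
  have := before_find 0 mk; rewrite nth_iota ?(ltn_trans mk) // add0n /p.
  by rewrite ltnNge => ->.
move=> [ns Fn lt_n]; suff -> : k = n by rewrite ns Fn.
have kn : k <= n.
  rewrite leqNgt; apply/negP => nk; have := before_find 0 nk.
  by rewrite nth_iota // add0n /p Fn.
apply/eqP; rewrite eqn_leq kn leqNgt; apply/negP => /lt_n.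
rewrite ltnNge; suff -> : F w (cpair x k) <= 1 by [].
have hp : has p (iota 0 (csnd w)) by rewrite has_find size_iota (leq_ltn_trans kn).
by have := nth_find 0 hp; rewrite nth_iota ?(leq_ltn_trans kn).
Qed.

Lemma rec_eval_mu F : rec2_in set0 F -> rec2_in set0 (eval_mu F).
Proof.
move=> rF; have rw : rec_in set0 (fun z => cfst z) by exact/rec_cfst/rec_id.
have rs : rec_in set0 (fun z => csnd (cfst z)) by exact: rec_csnd.
have rn : rec_in set0 (fun z =>
    find (fun m => F (cfst z) (cpair (csnd z) m) <= 1) (iota 0 (csnd (cfst z)))).
  apply: (@rec_find _ (fun z m => F (cfst z) (cpair (csnd z) m) <= 1)) => //.
  apply: rec_leq; last exact: rec_const.
  apply: (rec2_comp rF); first exact: rec_cfst.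
  by apply: rec_cpair; [exact: rec_csnd|exact/rec_csnd/rec_id].
apply: rec_ifte; [|exact: rec_succ|exact: rec_const].
apply: rec_andb; first by apply: rec_leq => //; exact: rec_succ.
apply: rec_eqn; last exact: rec_const.
by apply: (rec2_comp rF) => //; apply: rec_cpair => //; exact/rec_csnd/rec_id.
Qed.

Lemma evaluator_mu f F : evaluator f F -> evaluator (pf_mu f) (eval_mu F).
Proof.
move=> [rF mF FP].
split=> [|w w' x n sw' ww'|x n].
- exact: rec_eval_mu.
- move=> /eval_muP [ns Fn lt_n]; apply/eval_muP; split.
  + exact: leq_trans ns ww'.2.
  + exact: mF Fn.
  + move=> m /lt_n; case e: (F w _) => [|y] // y1.
    by rewrite (mF _ _ _ _ sw' ww' e).
split=> [[/FP [w sw Fn] lt_n]|[w sw /eval_muP [ns Fn lt_n]]]; last first.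
  split; first by apply/FP; exists w.
  move=> m /lt_n; case e: (F w _) => [|[|y]] // _; exists y.+1 => //.
  by apply/FP; exists w.
(* Only finitely many arguments precede the zero, so their fuels can be merged one after another. *)
have [w' sw' lt_n'] : exists2 w', sound_fuel w' &
    forall m, m < n -> 1 < F w' (cpair x m).
  elim: n lt_n {Fn} => [|n IHn] lt_n; first by exists w.
  have [m mn|w1 sw1 h1] := IHn; first by apply: lt_n; exact: ltnW.
  have [y /FP [w2 sw2 Fy] y0] := lt_n n (ltnSn n).
  have [w3 [sw3 w13 w23]] := fuel_directed sw1 sw2.
  exists w3 => // m; rewrite ltnS leq_eqVlt => /predU1P[->|/h1].
    by rewrite (mF _ _ _ _ sw3 w23 Fy) ltnS lt0n.
  by case e: (F w1 _) => [|y'] // y1; rewrite (mF _ _ _ _ sw3 w13 e).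
have [w1 [sw1 ww1 w'w1]] := fuel_directed sw sw'.
(* The fuel [cpair 0 n.+1] raises the search bound above [n] without adding oracle information. *)
have [w2 [sw2 w12 n2]] := fuel_directed sw1 (@sound_fuel0 n.+1).
have mF2 v m y : fuel_le v w1 -> F v (cpair x m) = y.+1 -> F w2 (cpair x m) = y.+1.
  by move=> vw1 /(mF _ _ _ _ sw1 vw1) /(mF _ _ _ _ sw2 w12).
exists w2 => //; apply/eval_muP; split.
- by move: n2.2; rewrite cpairE.
- exact: mF2 Fn.
- by move=> m /lt_n'; case e: (F w' _) => [|y] // y1; rewrite (mF2 _ _ _ w'w1 e).
Qed.

(** By induction on the derivation, it suffices to approximate the oracles in [O] from finite
    subsets of [X]. *)
Lemma partrec_evaluator (O : set (nat -> nat)) h :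
  (forall g, O g -> exists F, evaluator (pf_total g) F) ->
  partrec_in O h -> exists F, evaluator h F.
Proof.
move=> evO; elim=> [g /evO//|||||f g _ [F eF] _ [G eG]|f g _ [F eF] _ [G eG]
  |f g _ [F eF] _ [G eG]|f _ [F eF]].
- by eexists; apply: evaluator_total; exact: partrec_zero.
- by eexists; apply: evaluator_total; exact: partrec_succ.
- by eexists; apply: evaluator_total; exact: partrec_fst.
- by eexists; apply: evaluator_total; exact: partrec_snd.
- by eexists; exact: evaluator_pair eF eG.
- by eexists; exact: evaluator_comp eF eG.
- by eexists; exact: evaluator_prec eF eG.
- by eexists; exact: evaluator_mu eF.
Qed.

End FuelEvaluators.

(** * From Turing reducibility to enumeration reducibility for graph oracles *)

(* A finite part of the graph of [f] refutes [cpair n y] as soon as it contains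
   some [cpair n y'] with [y' != y]. *)
Definition eval_graph (w z : nat) : nat :=
  if odd (cfst w %/ 2 ^ z) then 2 else
  0 < count (fun z' => odd (cfst w %/ 2 ^ z') && (cfst z' == cfst z))
        (iota 0 (cfst w)).

(** The answers [2], [1] and [0] mean yes, no and undecided. Since [f] is total and single-valued,
    the one graph element with first coordinate [cfst z] settles the query [z] either way, so
    positive information is enough. *)
Lemma evaluator_graph f :
  evaluator (graph f) (pf_total (charfun (graph f))) eval_graph.
Proof.
have graphE z : graph f z <-> csnd z = f (cfst z).
  split=> [[n ->]|e]; first by rewrite !cpairE.
  by exists (cfst z); rewrite -e cpair_eta.
have graph_cfst_inj z z' : graph f z -> graph f z' -> cfst z = cfst z' -> z = z'.
  by move=> /graphE e1 /graphE e2 e; rewrite -(cpair_eta z) -(cpair_eta z') e1 e2 e.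
have eval2 w z : finset_code (cfst w) z -> eval_graph w z = 2.
  by rewrite /finset_code /eval_graph /= => ->.
have eval1 w z z' : ~ finset_code (cfst w) z -> finset_code (cfst w) z' ->
    cfst z' = cfst z -> eval_graph w z = 1.
  rewrite /eval_graph => /negP/negbTE -> wz' e; rewrite -has_count.
  suff -> : has (fun z' => odd (cfst w %/ 2 ^ z') && (cfst z' == cfst z))
    (iota 0 (cfst w)) by [].
  by apply/hasP; exists z'; [rewrite mem_iota finset_code_ltn|rewrite wz' e eqxx].
have evalP w z y : eval_graph w z = y.+1 ->
    finset_code (cfst w) z /\ y = 1 \/
    exists2 z', finset_code (cfst w) z' & cfst z' = cfst z /\ ~ finset_code (cfst w) z /\ y = 0.
  rewrite /eval_graph; case: ifP => [wz [<-]|wz]; first by left.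
  rewrite -has_count; case: hasP => //= -[z' _ /andP[wz' /eqP e]] [<-]; right.
  by exists z' => //; split=> //; split=> //; rewrite /finset_code /= wz.
split=> [|w w' z y sw' ww'|z y].
- apply: rec_ifte; last 2 first.
  + exact: rec_const.
  + apply: rec_leq; first exact: rec_const.
    apply: (@rec_count _ (fun x z' => odd (cfst (cfst x) %/ 2 ^ z') && (cfst z' == cfst (csnd x)))).
      apply: rec_andb.
        by apply: rec_mem_finset_code; [exact/rec_cfst/rec_cfst/rec_cfst/rec_id|exact/rec_csnd/rec_id].
      by apply: rec_eqn; [exact/rec_cfst/rec_csnd/rec_id|exact/rec_cfst/rec_csnd/rec_cfst/rec_id].
    exact/rec_cfst/rec_cfst/rec_id.
  + by apply: rec_mem_finset_code; [exact/rec_cfst/rec_cfst/rec_id|exact/rec_csnd/rec_id].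
(* A negative answer could be overturned only if the larger fuel also contained [z]; soundness would
   then put two points with the same first coordinate into the graph. *)
- move=> /evalP [[wz ->]|[z' wz' [e [wz ->]]]]; first exact/eval2/ww'.1.
  have w'z' := ww'.1 _ wz'; apply: (eval1 _ _ z') => // w'z; apply: wz.
  by rewrite -(graph_cfst_inj _ _ (sw' _ w'z') (sw' _ w'z) e).
split.
  (* The exponential codes the singleton of the graph point above [cfst z]; no search is made, so
     the bound is [0]. *)
  move=> ->; exists (cpair (2 ^ cpair (cfst z) (f (cfst z))) 0).
    by rewrite /sound_fuel cpairE finset_code_exp2 => _ ->; exists (cfst z).
  rewrite /charfun; case: (boolP (z \in graph f)) => [/set_mem|/negP nz] /=.
    by move=> /graphE e; apply: eval2; rewrite cpairE finset_code_exp2 -e cpair_eta.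
  apply: (eval1 _ _ (cpair (cfst z) (f (cfst z)))); rewrite !cpairE //.
    rewrite finset_code_exp2 /= => zE; apply: nz; apply/mem_set/graphE.
    by rewrite zE !cpairE.
  by rewrite finset_code_exp2.
move=> [w sw /evalP [[/sw wz ->]|[z' wz' [e [wz ->]]]]].
  by rewrite /pf_total /charfun mem_set.
rewrite /pf_total /charfun memNset // => zg; apply: wz.
by rewrite -(graph_cfst_inj _ _ (sw _ wz') zg e).
Qed.

Lemma turing_le_graph_enum_le (A : set nat) f :
  turing_le A (graph f) -> enum_le A (graph f).
Proof.
move=> /(@partrec_evaluator (graph f)) [g ->|F [rF mF FP]].
  by exists eval_graph; exact: evaluator_graph.
(* The operator pairs [u] with [n] when the information coded by [u] makes the computation answer
   yes within some bound [s]; [2] is the shifted value [1] of [charfun A]. *)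
exists [set z | exists s, F (cpair (cfst z) s) (csnd z) == 2].
  apply: (@ce_exists (fun z s => F (cpair (cfst z) s) (csnd z) == 2)).
  apply: rec_eqn; last exact: rec_const.
  apply: (rec2_comp rF); last exact/rec_csnd/rec_cfst/rec_id.
  by apply: rec_cpair; [exact/rec_cfst/rec_cfst/rec_id|exact/rec_csnd/rec_id].
apply/seteqP; split=> n.
  move=> An; have /FP [w sw Fw] : pf_total (charfun A) n 1.
    by rewrite /pf_total /charfun mem_set.
  exists (cfst w); split=> //; exists (csnd w); rewrite !cpairE.
  by rewrite cpair_eta Fw.
move=> [u [uX [s]]]; rewrite !cpairE => /eqP Fs.
have : pf_total (charfun A) n 1.
  by apply/FP; exists (cpair u s) => //; rewrite /sound_fuel cpairE.
by rewrite /pf_total /charfun; case: (boolP (n \in A)) => // /set_mem.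
Qed.

Lemma ce_projection (W : set nat) : ce W ->
  exists2 p : nat -> nat -> bool, rec_in set0 (fun z => p (cfst z) (csnd z)) &
    W = [set x | exists s, p x s].
Proof.
move=> [f /(@partrec_evaluator set0) [//|F [rF mF FP]] ->].
exists (fun x s => 0 < F (cpair 0 s) x).
  apply: rec_leq; first exact: rec_const.
  apply: (rec2_comp rF); last exact/rec_cfst/rec_id.
  by apply: rec_cpair; [exact: rec_const|exact/rec_csnd/rec_id].
apply/seteqP; split=> x /= [y].
  move=> /FP [w sw Fw]; exists (csnd w).
  (* Fuel that is sound for the empty set carries no elements, so its finite part can be replaced by
     the code [0]. *)
  rewrite (mF w _ x y) //; first exact: sound_fuel0.
  by split; rewrite cpairE // => z /sw.
case e: (F _ _) => [|r] // _; exists r; apply/FP.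
by exists (cpair 0 y) => //; exact: sound_fuel0.
Qed.

(** * Infinite subsets computable from an enumeration *)

(** A strictly increasing function on the naturals satisfies [n <= principal A n]. *)
Lemma infinite_set_ge (A : set nat) n : infinite_set A -> exists2 x, A x & n <= x.
Proof.
move=> Ainf; exists (principal A n); first by have [] := principalP n Ainf.
elim: n => // n IHn; exact: leq_ltn_trans IHn (ltn_principal Ainf (ltnSn n)).
Qed.

Lemma unbounded_infinite_set (A : set nat) :
  (forall n, exists2 x, A x & n <= x) -> infinite_set A.
Proof.
move=> Aunb /finite_seqP [s sE]; have [x] := Aunb (\max_(y <- s) y).+1.
by rewrite sE /= => xs; rewrite ltnNge (leq_bigmax_seq _ xs).
Qed.

(* With a decidable set of witnesses [w], each enumerating [csnd (cfst w)], keep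
   [x] only if the first witness enumerating a number [>= x] enumerates [x]
   itself: membership is then decidable, and the first number enumerated above
   any given bound is kept. *)
Lemma enum_le_infinite_subset (A X : set nat) : infinite_set A -> enum_le A X ->
  exists C, [/\ infinite_set C, C `<=` A & turing_le C X].
Proof.
move=> Ainf [Theta /ce_projection [p rp ThetaE] AE].
pose val w := csnd (cfst w).
(* A witness is [cpair (cpair u n) s], where [s] confirms the axiom [cpair u n] of [Theta]. Elements
   of a finite set are smaller than its code, so testing [z] below [u] decides the inclusion in
   [X]. *)
pose wit w := all (fun z => odd (cfst (cfst w) %/ 2 ^ z) ==> (z \in X))
  (iota 0 (cfst (cfst w))) && p (cfst w) (csnd w).
have rec_val f : rec_in [set charfun X] f -> rec_in [set charfun X] (fun x => val (f x)).
  by move=> rf; exact/rec_csnd/rec_cfst.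
have rec_wit : rec_in [set charfun X] (fun w => wit w).
  apply: rec_andb; last exact: rec_in_set0.
  apply: (@rec_all _ (fun w z => odd (cfst (cfst w) %/ 2 ^ z) ==> (z \in X))); last first.
    exact/rec_cfst/rec_cfst/rec_id.
  under eq_fun do rewrite implybE -[_ || _]negbK negb_or negbK.
  apply/rec_negb/rec_andb.
    apply: rec_mem_finset_code; first exact/rec_cfst/rec_cfst/rec_cfst/rec_id.
    exact/rec_csnd/rec_id.
  apply/rec_negb/(@rec_comp _ (charfun X)); last exact/rec_csnd/rec_id.
  exact: partrec_oracle.
have val_wit n : A n <-> exists2 w, wit w & val w = n.
  rewrite AE; split=> [[u [uX]]|[w /andP[/allP wX pw] <-]].
    rewrite ThetaE => -[s ps]; exists (cpair (cpair u n) s).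
      rewrite /wit !cpairE ps andbT; apply/allP => z _.
      by apply/implyP => /uX /mem_set.
    by rewrite /val !cpairE.
  exists (cfst (cfst w)); split; last by rewrite cpair_eta ThetaE; exists (csnd w).
  move=> z wz; apply/set_mem; have := wX z; rewrite mem_iota finset_code_ltn //.
  by move=> /(_ isT) /implyP; apply.
have exw x : exists w, wit w && (x <= val w).
  have [n /val_wit [w ww wn] xn] := infinite_set_ge x Ainf.
  by exists w; rewrite ww wn.
pose first_wit x := ex_minn (exw x).
exists [set x | val (first_wit x) = x]; split.
(* The first witness [w] for the bound [n] is also the first for the bound [val w]: it meets the
   latter, and any witness for [val w] is one for [n] because [n <= val w]. Hence [val w] is
   kept. *)
- apply: unbounded_infinite_set => n; pose w := first_wit n.
  exists (val w); rewrite /w /first_wit; last by case: ex_minnP => v /andP[].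
  case: ex_minnP => v /andP[wv nv] vmin /=; congr val; rewrite /first_wit.
  case: ex_minnP => v' /andP[wv' vv'] v'min; apply/eqP; rewrite eqn_leq.
  by rewrite v'min ?wv ?leqnn //= vmin // wv' (leq_trans nv).
- move=> x /= <-; apply/val_wit; exists (first_wit x) => //.
  by rewrite /first_wit; case: ex_minnP => w /andP[].
rewrite /turing_le.
have -> : charfun [set x | val (first_wit x) = x] = (fun x => val (first_wit x) == x).
  apply/funext => x; rewrite /charfun; congr nat_of_bool.
  by apply/idP/eqP => [/set_mem|e]; last exact: mem_set.
apply: rec_eqn; last exact: rec_id.
apply/rec_val/rec_ex_minn/rec_andb.
  by apply: (rec_comp rec_wit); exact/rec_csnd/rec_id.
by apply: rec_leq; [exact/rec_cfst/rec_id|exact/rec_val/rec_csnd/rec_id].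
Qed.

(** * Principal functions of subsets, and the equivalence *)

(** No search for elements of [C] is needed: a pair lies in the graph when its second coordinate is
    in [C] and the number of smaller elements of [C] is its first coordinate. *)
Lemma graph_principal_turing_le (C : set nat) : infinite_set C ->
  turing_le (graph (principal C)) C.
Proof.
move=> Cinf.
have rC : rec_in [set charfun C] (fun x => x \in C) by exact: partrec_oracle.
have graphE z : (z \in graph (principal C)) =
    (csnd z \in C) && (count_below C (csnd z) == cfst z).
  apply/idP/andP => [/set_mem [n ->]|[/set_mem Cz /eqP e]].
    by rewrite !cpairE; have [Cp ->] := principalP n Cinf; rewrite mem_set.
  apply/mem_set; exists (cfst z); have [Cp ep] := principalP (cfst z) Cinf.
  by rewrite -[LHS]cpair_eta; congr cpair; apply: count_below_inj Cz Cp _; rewrite e ep.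
rewrite /turing_le /charfun; under [X in pf_total X]eq_fun do rewrite graphE.
apply: rec_andb.
  by apply: (rec_comp rC); exact/rec_csnd/rec_id.
apply: rec_eqn; last exact/rec_cfst/rec_id.
apply: (@rec_count _ (fun _ y => y \in C)); last exact/rec_csnd/rec_id.
by apply: (rec_comp rC); exact/rec_csnd/rec_id.
Qed.

(** If [principal C n < principal A n], then [A] has fewer than [n] elements below [principal C n],
    although its subset [C] already has [n] there. *)
Lemma majorizes_principal_sub (A C : set nat) :
  infinite_set A -> infinite_set C -> C `<=` A ->
  majorizes (principal C) (principal A).
Proof.
move=> Ainf Cinf CA n; have [Cp Cn] := principalP n Cinf.
have [_ An] := principalP n Ainf.
rewrite leqNgt; apply/negP => /(ltn_count_below (CA _ Cp)).
rewrite An -{2}Cn ltnNge => /negP; apply.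
by apply: sub_count => y /set_mem /CA /mem_set.
Qed.

Theorem theorem5p3 (A : set nat) (Ainf : infinite_set A) :
  majorreducible A <-> majorenumerable A /\ introreducible A.
Proof.
split=> [Amaj|[Aenum Aintro] f fA].
  split=> [f /Amaj|C Cinf CA]; first exact: turing_le_graph_enum_le.
  apply: turing_le_trans (graph_principal_turing_le Cinf).
  exact/Amaj/majorizes_principal_sub.
have [C [Cinf CA CX]] := enum_le_infinite_subset Ainf (Aenum f fA).
exact: turing_le_trans (Aintro C Cinf CA) CX.
Qed.
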